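(* Let $R$ be an integral domain (not a field) that is finitely stable and an LPI-domain, and assume every maximal ideal of $R$ is stable. Then $R$ has finite character.
   Context: Let $R$ be an integral domain with quotient field $K\neq R$. For a nonzero ideal $I$ of $R$, $E(I):=(I:I)=\{x\in K: xI\subseteq I\}$. An ideal $I$ is locally principal if $IR_M$ is principal for every maximal ideal $M$ of $R$; it is invertible if $I(R:I)=R$, where $(R:I)=\{x\in K: xI\subseteq R\}$. $R$ is an LPI-domain if every locally principal nonzero ideal of $R$ is invertible. A nonzero ideal $I$ is stable if it is invertible as an ideal of the ring $E(I)$; $R$ is finitely stable if every nonzero finitely generated ideal of $R$ is stable. $R$ has finite character if every nonzero element of $R$ lies in only finitely many maximal ideals of $R$. *)

(* Defs.v *)
From HB Require Import structures.
From mathcomp Require Import all_boot all_order all_algebra.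
Set Implicit Arguments. Unset Strict Implicit. Unset Printing Implicit Defensive.
Import Order.TTheory GRing.Theory Num.Theory.
Local Open Scope ring_scope.

Section Defs.
Variable R : idomainType.
Local Notation K := {fraction R}.
Local Notation "x %:F" := (@FracField.tofrac R x).

Definition is_ideal (I : R -> Prop) : Prop :=
  I 0 /\ (forall a b, I a -> I b -> I (a + b)) /\ (forall r a, I a -> I (r * a)).

Definition nonzero_ideal (I : R -> Prop) : Prop :=
  is_ideal I /\ exists a, I a /\ a != 0.

Definition maximal_ideal (M : R -> Prop) : Prop :=
  is_ideal M /\ ~ M 1 /\
  forall J : R -> Prop, is_ideal J -> (forall x, M x -> J x) -> ~ J 1 ->
    forall x, J x -> M x.

Definition fin_gen (I : R -> Prop) : Prop :=
  exists s : seq R, forall x, I x <->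
    exists c : seq R, size c = size s /\ x = \sum_(i < size s) c`_i * s`_i.

Definition ext (I : R -> Prop) : K -> Prop := fun x => exists a, I a /\ x = a%:F.
Definition Rset : K -> Prop := ext (fun _ => True).

Definition mulset (A B : K -> Prop) : K -> Prop := fun z =>
  exists s : seq (K * K), (forall p, p \in s -> A p.1 /\ B p.2) /\
    z = \sum_(p <- s) p.1 * p.2.

Definition set_eq (A B : K -> Prop) : Prop := forall x, A x <-> B x.

Definition colon (T A : K -> Prop) : K -> Prop :=
  fun x => forall y, A y -> T (x * y).

Definition invertible_in (T A : K -> Prop) : Prop :=
  set_eq (mulset A (colon T A)) T.

Definition invertible (I : R -> Prop) : Prop := invertible_in Rset (ext I).

Definition endo (I : R -> Prop) : K -> Prop := colon (ext I) (ext I).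

Definition stable (I : R -> Prop) : Prop :=
  nonzero_ideal I /\ invertible_in (endo I) (ext I).

Definition loc (M : R -> Prop) : K -> Prop :=
  fun x => exists a s, ~ M s /\ x = a%:F / s%:F.

Definition locally_principal (I : R -> Prop) : Prop :=
  forall M, maximal_ideal M ->
    exists g : K, set_eq (mulset (ext I) (loc M)) (fun x => exists r, loc M r /\ x = g * r).

Definition LPI_domain : Prop :=
  forall I, nonzero_ideal I -> locally_principal I -> invertible I.

Definition finitely_stable : Prop :=
  forall I, nonzero_ideal I -> fin_gen I -> stable I.

Definition finite_character : Prop :=
  forall x : R, x != 0 ->
    exists (n : nat) (f : nat -> R -> Prop),
      forall M, maximal_ideal M -> M x ->
        exists i, (i < n)%N /\ forall y, M y <-> f i y.

Definition not_field : Prop := exists x : K, ~ Rset x.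
End Defs.

(* Main.v *)
(** Suppose [x != 0] lies in infinitely many maximal ideals.

    For [x, y] in a maximal ideal [M], stability of [(x, y)] forces a quadratic
    relation [c0 x^2 + c1 x y + c2 y^2 = 0] whose coefficients are not all in
    [M], so some [b] among [x, y, x + y] divides [x^2] and [y^2] in [R_M].
    Stability of [M] gives finitely many [m_i] in [M] whose ideal contains
    [t^2] for every [t] in [M], hence lies in no other maximal ideal. Iterating
    the first step over the [m_i] and [x] yields [b] in [M] such that
    [J := b R_M] intersected with [R] contains [x^2] and powers of the [m_i];
    so [J] is locally principal, hence invertible, and [M] is the only maximal
    ideal containing it.

    An infinite sequence of such [J_n] containing [y := x^2] is impossible: the
    union [I] of the ideals [y (J_0 ... J_(n-1))^-1] is locally principal since
    at most one [J_n] is nontrivial at each maximal ideal; hence [I] is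
    invertible, so finitely generated, so the union is stationary, whereas
    [J_n] is proper for every [n]. *)

Require Import Defs.
From mathcomp Require Import all_boot all_order all_algebra.
From mathcomp Require Import ring.
From Stdlib Require Import Classical ClassicalEpsilon.
Set Implicit Arguments. Unset Strict Implicit. Unset Printing Implicit Defensive.
Import GRing.Theory.
Local Open Scope ring_scope.

(** * Fraction identities for local generators *)

Lemma scaled_fracD (F : fieldType) (u c t d f w e v : F) :
  t != 0 -> d != 0 -> w != 0 -> v != 0 ->
  u * c / (t * d) * (f / w) + c / d * (e / v) =
  c / d * ((u * f * v + t * w * e) / (t * w * v)).
Proof. by move=> t0 d0 w0 v0; field; rewrite t0 d0 w0 v0. Qed.

Lemma scaled_fracM (F : fieldType) (t d a s e v : F) :
  s != 0 -> d != 0 -> v != 0 ->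
  t * d * a / s / d * (e / v) = a * (t * e / (s * v)).
Proof. by move=> s0 d0 v0; field; rewrite s0 d0 v0. Qed.

Section Ideals.
Variable R : idomainType.
Local Notation K := {fraction R}.
Local Notation "x %:F" := (@FracField.tofrac R x).

(** * Maximal ideals: primality and separation *)

Lemma ideal_opp (N : R -> Prop) a : is_ideal N -> N a -> N (- a).
Proof. by case=> _ [_ NM] Na; rewrite -mulN1r; apply: NM. Qed.

Lemma maximal_prime (M : R -> Prop) a b :
  maximal_ideal M -> M (a * b) -> ~ M a -> M b.
Proof.
move=> [[M0 [MD MM]] [M1 Mmax]] Mab Ma.
pose J z := exists m r, M m /\ z = m + r * a.
have idJ : is_ideal J.
  split; first by exists 0, 0; split=> //; ring.
  split.
    move=> _ _ [m [r [Mm ->]]] [m' [r' [Mm' ->]]].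
    by exists (m + m'), (r + r'); split; [apply: MD | ring].
  move=> c _ [m [r [Mm ->]]].
  by exists (c * m), (c * r); split; [apply: MM | ring].
have [[m [r [Mm E]]] | J1] := classic (J 1).
  have -> : b = b * m + r * (a * b) by rewrite -[LHS]mulr1 E; ring.
  by apply: MD; apply: MM.
case: Ma; apply: (Mmax J) => //.
  by move=> z Mz; exists z, 0; split=> //; ring.
by exists 0, 1; split=> //; ring.
Qed.

Lemma maximal_mulN (M : R -> Prop) a b :
  maximal_ideal M -> ~ M a -> ~ M b -> ~ M (a * b).
Proof. by move=> maxM Ma Mb Mab; apply: Mb; apply: maximal_prime Mab Ma. Qed.

Lemma maximal_expN (M : R -> Prop) a n :
  maximal_ideal M -> ~ M a -> ~ M (a ^+ n).
Proof.
move=> maxM Ma; elim: n => [|n IH]; first by case: maxM => _ [].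
by rewrite exprS; apply: maximal_mulN.
Qed.

Lemma maximal_prodN (M : R -> Prop) n (f : nat -> R) :
  maximal_ideal M -> (forall i, (i < n)%N -> ~ M (f i)) ->
  ~ M (\prod_(i < n) f i).
Proof.
move=> maxM; elim: n => [|n IH] Mf.
  by rewrite big_ord0; case: maxM => _ [].
rewrite big_ord_recr; apply: maximal_mulN => //; last exact: Mf.
by apply: IH => i lt_in; apply: Mf; apply: ltnW.
Qed.

Lemma maximal_neq0 (M : R -> Prop) s : maximal_ideal M -> ~ M s -> s != 0.
Proof. by case=> [[M0 _] _] Ms; apply/eqP=> s0; rewrite s0 in Ms. Qed.

Lemma maximal_sep (M N : R -> Prop) :
  maximal_ideal M -> maximal_ideal N -> ~ (forall z, N z <-> M z) ->
  exists t, M t /\ ~ N t.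
Proof.
move=> [idM [M1 Mmax]] [idN [N1 Nmax]] neqNM; apply: NNPP => noT.
have MN z : M z -> N z by move=> Mz; apply: NNPP => Nz; apply: noT; exists z.
by apply: neqNM => z; split; [apply: (Mmax N) | apply: MN].
Qed.

(** * Finite generation from invertibility and stability *)

Lemma tofrac_neq0 (s : R) : s != 0 -> s%:F != 0.
Proof. by rewrite tofrac_eq0. Qed.

Lemma mulset_ext_rep (I : R -> Prop) (B : K -> Prop) z :
  mulset (ext I) B z -> exists s : seq (R * K),
    (forall p, p \in s -> I p.1 /\ B p.2) /\ z = \sum_(p <- s) p.1%:F * p.2.
Proof.
case=> s [sP ->]; elim: s sP => [|p s IH] sP.
  by exists [::]; rewrite !big_nil.
have [|t [tP tE]] := IH; first by move=> q qs; apply: sP; rewrite inE qs orbT.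
have [[a [Ia aE]] Bp] := sP p (mem_head _ _).
exists ((a, p.2) :: t); split=> [q|]; last by rewrite !big_cons tE aE.
by rewrite inE => /orP[/eqP ->|/tP].
Qed.

(** Multiplying [1 = \sum m_i g_i] by [t] gives [t = \sum (g_i t) m_i], with coefficients in [R].
    Quantifying over the ideals [N] that contain [s] replaces the span of [s]. *)
Lemma unit_ideal_fg (I : R -> Prop) (B : K -> Prop) :
  mulset (ext I) B 1 -> exists s : seq R,
    (forall m, m \in s -> I m) /\
    (forall N t, is_ideal N -> (forall m, m \in s -> N m) ->
      (forall g, B g -> Rset (g * t%:F)) -> N t).
Proof.
move=> /mulset_ext_rep [s [sP sE]]; exists (map fst s); split.
  by move=> _ /mapP[p ps ->]; case: (sP p ps).
move=> N t [N0 [ND NM]] sN tB.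
suff [c [Nc]] : exists c, N c /\ t%:F = c%:F.
  by move=> /eqP; rewrite tofrac_eq => /eqP ->.
rewrite -[t%:F]mul1r sE big_distrl /=.
elim: s sP sN {sE} => [|p s IH] sP sN.
  by exists 0; rewrite big_nil tofrac0.
have [| |c [Nc cE]] := IH.
- by move=> q qs; apply: sP; rewrite inE qs orbT.
- by move=> q qs; apply: sN; rewrite inE qs orbT.
have [_ Bp] := sP p (mem_head _ _).
have [d [_ dE]] := tB _ Bp.
exists (d * p.1 + c); split.
  by apply: ND => //; apply: NM; apply: sN; rewrite /= mem_head.
by rewrite big_cons cE -mulrA dE tofracD tofracM mulrC.
Qed.

Lemma colon_self1 (A : K -> Prop) : colon A A 1.
Proof. by move=> y; rewrite mul1r. Qed.

(** For [g] in [(E(I) : I)] and [t] in [I], the product [(g t) t] lies in [I], so [g t^2] is in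
    [R]. *)
Lemma stable_sqr_fg (I : R -> Prop) :
  stable I -> exists s : seq R,
    (forall m, m \in s -> I m) /\
    (forall N t, is_ideal N -> (forall m, m \in s -> N m) -> I t -> N (t ^+ 2)).
Proof.
case=> _ /(_ 1)[_ /(_ (@colon_self1 _))/unit_ideal_fg[s [sI sN]]].
exists s; split=> // N t idN Ns It; apply: sN => // g gI.
have ItF : ext I t%:F by exists t.
have [c [_ cE]] := gI _ ItF _ ItF.
by exists c; split=> //; rewrite -cE expr2 tofracM mulrA.
Qed.

Lemma invertible_fg (I : R -> Prop) :
  invertible I -> exists s : seq R,
    (forall m, m \in s -> I m) /\
    (forall N t, is_ideal N -> (forall m, m \in s -> N m) -> I t -> N t).
Proof.
case/(_ 1)=> _ /(_ (ex_intro _ 1 (conj Logic.I (esym (tofrac1 R)))))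
  /unit_ideal_fg[s [sI sN]].
by exists s; split=> // N t idN Ns It; apply: sN => // g; apply; exists t.
Qed.

(** * Local divisors from finite stability *)

(** The choice of [b] follows the coefficient outside [M]: [x] for [c2], [y] for [c0], and [x + y]
    when only [c1] is left. *)
Lemma quadratic_local_divisor (M : R -> Prop) x y c0 c1 c2 :
  maximal_ideal M -> x != 0 -> M x -> M y ->
  c0 * x ^+ 2 + c1 * (x * y) + c2 * y ^+ 2 = 0 ->
  ~ (M c0 /\ M c1 /\ M c2) ->
  exists b s u v, [/\ M b, b != 0, ~ M s, s * x ^+ 2 = u * b
    & s * y ^+ 2 = v * b].
Proof.
move=> maxM x0 Mx My E cM.
have [[M0 [MD MM]] [M1 _]] := maxM.
suff [b [s [u [v [Mb Ms E1 E2]]]]] : exists b s u v,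
    [/\ M b, ~ M s, s * x ^+ 2 = u * b & s * y ^+ 2 = v * b].
  (* [b] cannot vanish: [s * x ^+ 2 = u * b] and neither [s] nor [x] is zero. *)
  exists b, s, u, v; split=> //; apply: contraNneq x0 => b0.
  move/eqP: E1; rewrite b0 mulr0 mulf_eq0 expf_eq0 /=.
  by rewrite (negPf (maximal_neq0 maxM Ms)).
have [Mc2|Mc2] := classic (M c2); last first.
  exists x, c2, (c2 * x), (- (c0 * x + c1 * y)); split=> //; first by ring.
  by apply/eqP; rewrite -subr_eq0 -E; apply/eqP; ring.
have [Mc0|Mc0] := classic (M c0); last first.
  exists y, c0, (- (c2 * y + c1 * x)), (c0 * y); split=> //; last by ring.
  by apply/eqP; rewrite -subr_eq0 -E; apply/eqP; ring.
have Mc1 : ~ M c1 by move=> Mc1; apply: cM.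
(* substituting [x = (x + y) - y] makes the coefficient of [y ^+ 2] a unit *)
pose s := c1 - c0 - c2; pose w := c0 * (x + y) + (c1 - c0 *+ 2) * y.
have Ms : ~ M s.
  move=> Ms; apply: Mc1; have -> : c1 = s + (c0 + c2) by rewrite /s; ring.
  by apply: (MD _ _ Ms); apply: MD.
have Ey : s * y ^+ 2 = w * (x + y).
  by apply/eqP; rewrite eq_sym -subr_eq0 -E; apply/eqP; rewrite /s /w; ring.
exists (x + y), s, (s * (x - y) + w), w; split=> //; first exact: MD.
by rewrite [RHS]mulrDl -Ey; ring.
Qed.

(** Stability of [I = (x, y)] puts [1] in [I (E(I) : I)]; grouping the terms of that sum by
    generator leaves one multiplier [g] of [x] and one [h] of [y]. *)
Lemma finitely_stable_pair x y :
  finitely_stable R -> x != 0 -> exists g h : K,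
    g * x%:F + h * y%:F = 1 /\
    (forall k a b, k \in [:: g; h] -> a \in [:: x; y] -> b \in [:: x; y] ->
       exists u v, k * a%:F * b%:F = (u * x + v * y)%:F).
Proof.
move=> fs x0; pose I z := exists u v, z = u * x + v * y.
have idI : is_ideal I.
  split; first by exists 0, 0; ring.
  split=> [_ _ [u [v ->]] [u' [v' ->]] | r _ [u [v ->]]].
    by exists (u + u'), (v + v'); ring.
  by exists (r * u), (r * v); ring.
have Ix : I x by exists 1, 0; ring.
have Iy : I y by exists 0, 1; ring.
have [|| _ /(_ 1)[_ /(_ (@colon_self1 _))]] := fs I.
- by split=> //; exists x.
- exists [:: x; y] => z; split=> [[u [v ->]] | [c [_ ->]]].
    by exists [:: u; v]; split=> //; rewrite !big_ord_recl big_ord0 /= addr0.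
  by exists c`_0, c`_1; rewrite !big_ord_recl big_ord0 /= addr0.
move=> /mulset_ext_rep[s [sP ->]].
(* [B k] says that [k I^2] is inside [I], checked on generators. *)
pose B k := forall a b, a \in [:: x; y] -> b \in [:: x; y] ->
  exists u v, k * a%:F * b%:F = (u * x + v * y)%:F.
have [g [h [Bg Bh E]]] : exists g h, [/\ B g, B h
    & \sum_(p <- s) p.1%:F * p.2 = g * x%:F + h * y%:F].
  elim: s sP => [|p s IH] sP.
    exists 0, 0; split; last by rewrite big_nil !mul0r addr0.
    - by move=> a b _ _; exists 0, 0; rewrite !mul0r addr0 tofrac0.
    - by move=> a b _ _; exists 0, 0; rewrite !mul0r addr0 tofrac0.
  have [|g [h [Bg Bh E]]] := IH.
    by move=> q qs; apply: sP; rewrite inE qs orbT.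
  have [[u [v pE]] Bp] := sP p (mem_head _ _).
  have IF a : a \in [:: x; y] -> ext I a%:F.
    by rewrite !inE => /orP[]/eqP->; [exists x|exists y].
  have Bcomb k c : B k -> B (k + c%:F * p.2).
    move=> Bk a b Ha Hb; have [u1 [v1 E1]] := Bk a b Ha Hb.
    have [_ [[u2 [v2 ->]] E2]] := Bp _ (IF _ Ha) _ (IF _ Hb).
    exists (u1 + c * u2), (v1 + c * v2).
    rewrite !mulrDl E1 -!mulrA (mulrA p.2) E2 -tofracM -tofracD.
    by congr (_ %:F); ring.
  exists (g + u%:F * p.2), (h + v%:F * p.2); split; try exact: Bcomb.
  by rewrite big_cons E pE !tofracD !tofracM; ring.
exists g, h; split=> // k a b kgh Ha Hb.
by move: kgh; rewrite !inE => /orP[]/eqP->; [apply: Bg|apply: Bh].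
Qed.

(** Multiplying [g x + h y = 1] by [x], [y], [x^2], [x y] and [y^2] gives five relations over [R];
    one of them must have a coefficient outside [M]. *)
Lemma finitely_stable_local_divisor (M : R -> Prop) x y :
  finitely_stable R -> maximal_ideal M -> x != 0 -> M x -> M y ->
  exists b s u v, [/\ M b, b != 0, ~ M s, s * x ^+ 2 = u * b
    & s * y ^+ 2 = v * b].
Proof.
move=> fs maxM x0 Mx My.
have [g [h [E gh]]] := finitely_stable_pair y fs x0.
have /= [gxx [gxx' Egxx]] := gh g x x (mem_head _ _) (mem_head _ _) (mem_head _ _).
have [||| gxy [gxy' Egxy]] := gh g x y; rewrite ?inE ?eqxx ?orbT //.
have [||| gyy [gyy' Egyy]] := gh g y y; rewrite ?inE ?eqxx ?orbT //.
have [||| hxx [hxx' Ehxx]] := gh h x x; rewrite ?inE ?eqxx ?orbT //.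
have [||| hxy [hxy' Ehxy]] := gh h x y; rewrite ?inE ?eqxx ?orbT //.
have [||| hyy [hyy' Ehyy]] := gh h y y; rewrite ?inE ?eqxx ?orbT //.
have Rel a (A B : R) : g * x%:F * a%:F = A%:F -> h * y%:F * a%:F = B%:F ->
    a = A + B.
  move=> EA EB; apply/eqP; rewrite -tofrac_eq tofracD -EA -EB.
  by rewrite -mulrDl E mul1r.
have Rx : x = (gxx + hxy) * x + (gxx' + hxy') * y.
  rewrite [LHS](Rel _ (gxx * x + gxx' * y) (hxy * x + hxy' * y)) //; first by ring.
  by rewrite -Ehxy; ring.
have Ry : y = (gxy + hyy) * x + (gxy' + hyy') * y.
  by rewrite [LHS](Rel _ (gxy * x + gxy' * y) (hyy * x + hyy' * y)) //; ring.
have Rxx : x * x = (gxx * x + gxx' * y) * x + (hxx * x + hxx' * y) * y.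
  by apply: Rel; rewrite !tofracM -?Egxx -?Ehxx; ring.
have Rxy : x * y = (gxy * x + gxy' * y) * x + (hxy * x + hxy' * y) * y.
  by apply: Rel; rewrite !tofracM -?Egxy -?Ehxy; ring.
have Ryy : y * y = (gyy * x + gyy' * y) * x + (hyy * x + hyy' * y) * y.
  by apply: Rel; rewrite !tofracM -?Egyy -?Ehyy; ring.
(* Otherwise all the coefficients of these relations are in [M], which makes
   [1] a combination of elements of [M]. *)
apply: NNPP => noB.
(* [w] brings every relation to degree two: it is [x] or [y] for the two linear ones and [1] for the
   others. *)
have allM A B w c0 c1 c2 : A = B ->
    c0 * x ^+ 2 + c1 * (x * y) + c2 * y ^+ 2 = (A - B) * w ->
    M c0 /\ M c1 /\ M c2.
  move=> ->; rewrite subrr mul0r => Ec; apply: NNPP => cM; apply: noB.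
  exact: quadratic_local_divisor Ec cM.
have [Mx1 _] : M (1 - gxx - hxy) /\ M (- (gxx' + hxy')) /\ M 0.
  by apply: (allM _ _ x _ _ _ Rx); ring.
have [_ [_ My1]] : M 0 /\ M (- (gxy + hyy)) /\ M (1 - gxy' - hyy').
  by apply: (allM _ _ y _ _ _ Ry); ring.
have [Mx2 _] : M (1 - gxx) /\ M (- (gxx' + hxx)) /\ M (- hxx').
  by apply: (allM _ _ 1 _ _ _ Rxx); ring.
have [_ [Mxy _]] : M (- gxy) /\ M (1 - gxy' - hxy) /\ M (- hxy').
  by apply: (allM _ _ 1 _ _ _ Rxy); ring.
have [_ [_ My2]] : M (- gyy) /\ M (- (gyy' + hyy)) /\ M (1 - hyy').
  by apply: (allM _ _ 1 _ _ _ Ryy); ring.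
have [idM [M1 _]] := maxM; have [_ [MD _]] := idM.
apply: M1.
(* The second and third groups reduce to [hxy] and [gxy'], cancelling these terms of the first. *)
have -> : 1 = (1 - gxy' - hxy) + (- (1 - gxx - hxy) + (1 - gxx))
   + (- (1 - gxy' - hyy') + (1 - hyy')) by ring.
apply: (MD); first apply: (MD _ _ Mxy).
  by apply: (MD _ _ _ Mx2); apply: ideal_opp.
by apply: (MD _ _ _ My2); apply: ideal_opp.
Qed.

(** * Local generators, and ideals contained in a single maximal ideal *)

(** Cleared of denominators, the hypotheses say that each [a] in [I] lies in [(c / d) R_M], and that
    [c / d] lies in [a R_M] for some [a] in [I]. *)
Lemma loc_principal_frac (I M : R -> Prop) c d :
  maximal_ideal M -> d != 0 ->
  (forall a, I a -> exists s u, ~ M s /\ s * d * a = u * c) ->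
  (exists a s t, [/\ I a, ~ M s & s * c = t * d * a]) ->
  exists g : K, set_eq (mulset (ext I) (loc M))
    (fun x => exists r, loc M r /\ x = g * r).
Proof.
move=> maxM d0 Ic [a0 [s0 [t0 [Ia0 Ms0 E0]]]].
have M1 : ~ M 1 by case: maxM => _ [].
have nz s : ~ M s -> s%:F != 0.
  by move=> Ms; apply: tofrac_neq0; apply: maximal_neq0 maxM Ms.
have dF0 := tofrac_neq0 d0.
exists (c%:F / d%:F) => z; split.
  move=> /mulset_ext_rep[s [sP ->]]; elim: s sP => [|p s IH] sP.
    exists 0; rewrite big_nil mulr0; split=> //.
    by exists 0, 1; rewrite tofrac0 mul0r.
  have [|_ [[e [v [Mv ->]]] E]] := IH.
    by move=> q qs; apply: sP; rewrite inE qs orbT.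
  have [Ip [f [w [Mw pE]]]] := sP p (mem_head _ _).
  have [t [u [Mt tE]]] := Ic _ Ip.
  exists ((u * f * v + t * w * e)%:F / (t * w * v)%:F); split.
    by exists (u * f * v + t * w * e), (t * w * v); split=> //; do !apply: maximal_mulN.
  have {}tE : p.1%:F = u%:F * c%:F / (t%:F * d%:F).
    rewrite -tofracM -tE !tofracM [_ * p.1%:F]mulrC mulfK //.
    by rewrite mulf_neq0 ?dF0 ?nz.
  rewrite big_cons E pE tE !tofracD !tofracM.
  by apply: scaled_fracD; rewrite ?dF0 ?nz.
move=> [_ [[e [v [Mv ->]]] ->]].
exists [:: (a0%:F, (t0 * e)%:F / (s0 * v)%:F)]; split.
  move=> p; rewrite inE => /eqP -> /=; split; first by exists a0.
  by exists (t0 * e), (s0 * v); split=> //; apply: maximal_mulN.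
rewrite big_seq1 /=.
have cE : c%:F = t0%:F * d%:F * a0%:F / s0%:F.
  by rewrite -!tofracM -E0 tofracM mulrC mulKf ?nz.
by rewrite cE !tofracM; apply: scaled_fracM; rewrite ?dF0 ?nz.
Qed.

(** A local divisor of [b' ^+ 2] and [m ^+ 2] takes in one more [m] and doubles the exponents of the
    earlier entries. *)
Lemma local_divisor_seq (M : R -> Prop) x (s : seq R) :
  finitely_stable R -> maximal_ideal M -> x != 0 -> M x ->
  (forall m, m \in s -> M m) ->
  exists b, [/\ M b, b != 0 & forall m, m \in s ->
    exists t u n, ~ M t /\ t * m ^+ n = u * b].
Proof.
move=> fs maxM x0 Mx; elim: s => [|m s IH] sM; first by exists x.
have [|b' [Mb' b'0 b'P]] := IH.
  by move=> q qs; apply: sM; rewrite inE qs orbT.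
have [b [t [u [v [Mb b0 Mt Eb Em]]]]] :=
  finitely_stable_local_divisor fs maxM b'0 Mb' (sM m (mem_head _ _)).
exists b; split=> // q; rewrite inE => /orP[/eqP ->|/b'P[t' [u' [n [Mt' E']]]]].
  by exists t, v, 2%N.
exists (t * t' ^+ 2), (u' ^+ 2 * u), (n * 2)%N; split.
  by apply: maximal_mulN => //; apply: maximal_expN.
by rewrite exprM -mulrA -exprMn E' exprMn mulrCA Eb mulrA.
Qed.

Lemma local_ideal (M : R -> Prop) x :
  finitely_stable R -> LPI_domain R -> maximal_ideal M -> stable M ->
  x != 0 -> M x ->
  exists (J : R -> Prop) b s,
    [/\ M b, b != 0, J b & J (x ^+ 2)] /\
    [/\ ~ M s, forall j, J j -> exists u, s * j = u * b
      & forall N, maximal_ideal N -> ~ (forall z, N z <-> M z) ->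
          exists j, J j /\ ~ N j].
Proof.
move=> fs lpi maxM stM x0 Mx.
have M1 : ~ M 1 by case: maxM => _ [].
have [l [lM lsq]] := stable_sqr_fg stM.
have [b' [Mb' b'0 b'P]] := local_divisor_seq fs maxM x0 Mx lM.
(* Pairing [b'] with [x] puts [x ^+ 2] in [J], an element that does not depend on [M]. *)
have [b [t [u [v [Mb b0 Mt Ex Eb']]]]] :=
  finitely_stable_local_divisor fs maxM x0 Mx Mb'.
pose J r := exists s w, ~ M s /\ s * r = w * b.
have idJ : is_ideal J.
  split; first by exists 1, 0; rewrite mulr0 mul0r.
  split=> [a a' [s [w [Ms E]]] [s' [w' [Ms' E']]] | r a [s [w [Ms E]]]].
    exists (s * s'), (s' * w + s * w'); split; first exact: maximal_mulN.
    rewrite mulrDl -!mulrA -E -E'; ring.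
  by exists s, (r * w); split=> //; rewrite mulrCA E mulrA.
have Jb : J b by exists 1, 1.
have sepJ N : maximal_ideal N -> ~ (forall z, N z <-> M z) ->
    exists j, J j /\ ~ N j.
  move=> maxN neqNM; have [y [My Ny]] := maximal_sep maxM maxN neqNM.
  have [m ml Nm] : exists2 m, m \in l & ~ N m.
    apply: NNPP => noM; apply: (@maximal_expN N y 2 maxN Ny).
    apply: lsq => //; first by case: maxN.
    by move=> m ml; apply: NNPP => Nm; apply: noM; exists m.
  have [s [w [n [Ms E]]]] := b'P m ml.
  exists (m ^+ (n * 2)); split; last exact: maximal_expN.
  exists (t * s ^+ 2), (w ^+ 2 * v); split.
    by apply: maximal_mulN => //; apply: maximal_expN.
  by rewrite exprM -mulrA -exprMn E exprMn mulrCA Eb' mulrA.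
have invJ : invertible J.
  apply: lpi; first by split=> //; exists b.
  (* [J R_N] is generated by [b] if [N] is [M], and by [1] otherwise, since [J] then has an element
     outside [N]. *)
  move=> N maxN; have [eqNM|/(sepJ N maxN)[j [Jj Nj]]] :=
    classic (forall z, N z <-> M z).
    apply: (@loc_principal_frac _ _ b 1) => //; first exact: oner_neq0.
      by move=> a [s [w [Ms E]]]; exists s, w; rewrite mulr1; split=> // /eqNM.
    by exists b, 1, 1; split; rewrite ?mulr1 // => /eqNM.
  have N1 : ~ N 1 by case: maxN => _ [].
  apply: (@loc_principal_frac _ _ 1 1) => //; first exact: oner_neq0.
    by move=> a _; exists 1, a; rewrite mulr1 mul1r mulr1.
  by exists j, j, 1; split=> //; rewrite !mul1r mulr1.
have [k [kJ kspan]] := invertible_fg invJ.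
(* The product of the denominators of finitely many generators serves for all of [J]. *)
have [s [Ms sk]] : exists s, ~ M s /\ forall j, j \in k -> exists u, s * j = u * b.
  elim: k kJ {kspan} => [|j k IH] kJ; first by exists 1.
  have [|s [Ms sk]] := IH; first by move=> q qk; apply: kJ; rewrite inE qk orbT.
  have [s' [w [Ms' E]]] := kJ j (mem_head _ _).
  exists (s * s'); split; first exact: maximal_mulN.
  move=> q; rewrite inE => /orP[/eqP ->|/sk[w' E']].
    by exists (s * w); rewrite -mulrA E mulrA.
  by exists (s' * w'); rewrite mulrAC E' mulrC mulrA.
exists J, b, s; split; split=> //; first by exists t, u.
move=> j; apply: (kspan (fun j => exists w, s * j = w * b)) => //.
split; first by exists 0; rewrite mulr0 mul0r.
split=> [a a' [w E] [w' E'] | r a [w E]].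
  by exists (w + w'); rewrite mulrDr mulrDl E E'.
by exists (r * w); rewrite mulrCA E mulrA.
Qed.

(** * Infinite families of ideals containing a common nonzero element *)

Lemma no_infinite_comaximal_family (y : R) (M J : nat -> R -> Prop)
    (b s : nat -> R) :
  LPI_domain R -> y != 0 -> (forall n, maximal_ideal (M n)) ->
  (forall i j, i <> j -> ~ (forall z, M i z <-> M j z)) ->
  (forall n, [/\ M n (b n), b n != 0, J n (b n) & J n y]) ->
  (forall n, [/\ ~ M n (s n), forall j, J n j -> exists u, s n * j = u * b n
      & forall N, maximal_ideal N -> ~ (forall z, N z <-> M n z) ->
          exists j, J n j /\ ~ N j]) -> False.
Proof.
move=> lpi y0 maxM neqM HJ HM.
(* [In n] is [y (J_0 ... J_(n-1))^-1] *)
pose In n r := forall f : nat -> R, (forall i, (i < n)%N -> J i (f i)) ->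
  exists c, r * \prod_(i < n) f i = c * y.
pose I r := exists n, In n r.
have idIn n : is_ideal (In n).
  split; first by move=> f _; exists 0; rewrite !mul0r.
  split=> [a a' Ha Ha' f Hf | r a Ha f Hf].
    have [c E] := Ha f Hf; have [c' E'] := Ha' f Hf.
    by exists (c + c'); rewrite !mulrDl E E'.
  by have [c E] := Ha f Hf; exists (r * c); rewrite -!mulrA E.
have In_le n m r : (n <= m)%N -> In n r -> In m r.
  move=> /subnKC <-; elim: (m - n)%N => [|k IH] Hr; first by rewrite addn0.
  move=> f Hf; have [|c E] := IH Hr f.
    by move=> i Hi; apply: Hf; rewrite addnS ltnS ltnW.
  exists (c * f (n + k)%N).
  by rewrite addnS big_ord_recr /= mulrA E mulrAC.
have idI : is_ideal I.
  split; first by exists 0%N; case: (idIn 0%N).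
  split=> [a a' [n Ha] [n' Ha'] | r a [n Ha]]; last first.
    by exists n; have [_ [_]] := idIn n; apply.
  exists (maxn n n'); have [_ [ID _]] := idIn (maxn n n').
  by apply: ID; [apply: In_le Ha; rewrite leq_maxl | apply: In_le Ha'; rewrite leq_maxr].
have Iy : I y by exists 0%N => f _; exists 1; rewrite big_ord0 mulr1 mul1r.
(* [y / b_k] lies in [I] locally at [M_k] *)
have Iyb k : exists r, I r /\ r * b k = s k * y.
  have [_ _ _ Jy] := HJ k; have [_ sJ _] := HM k.
  (* [k.+1] rather than [k]: the product needs its factor [f k], since [s k * f k] is a multiple of
     [b k]. *)
  have [r rE] := sJ _ Jy; exists r; split=> //; exists k.+1 => f Hf.
  have [u uE] := sJ _ (Hf k (ltnSn k)).
  exists (\prod_(i < k) f i * u).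
  have [_ bk0 _ _] := HJ k; apply: (mulIf bk0).
  rewrite big_ord_recr /=.
  transitivity (\prod_(i < k) f i * f k * (r * b k)); first by ring.
  rewrite -rE.
  transitivity (\prod_(i < k) f i * (s k * f k) * y); first by ring.
  by rewrite uE; ring.
(* Each [J i] with [i < n] has an element outside [N]; the product of these is the denominator
   [t]. *)
have avoid N n : maximal_ideal N ->
    (forall i, (i < n)%N -> ~ (forall z, N z <-> M i z)) ->
  forall r, In n r -> exists t c, ~ N t /\ t * r = c * y.
  move=> maxN neqN r Hr.
  have [f fP] : exists f : nat -> R, forall i, (i < n)%N -> J i (f i) /\ ~ N (f i).
    have ex i : exists j, (i < n)%N -> J i j /\ ~ N j.
      have [lt_in|_] := boolP (i < n)%N; last by exists 0.
      have [_ _ /(_ N maxN (neqN i lt_in))[j jP]] := HM i.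
      by exists j.
    exact: (choice _ ex).
  have [c E] := Hr f (fun i lt_in => proj1 (fP i lt_in)).
  exists (\prod_(i < n) f i), c; split; last by rewrite mulrC.
  by apply: (@maximal_prodN N n f maxN) => i lt_in; case: (fP i lt_in).
have invI : invertible I.
  apply: lpi; first by split=> //; exists y.
  move=> N maxN; have N1 : ~ N 1 by case: maxN => _ [].
  (* The local generator of [I] is [y / b k] at [M k], and [y] at every other maximal ideal. *)
  have [[k eqNM]|neqN] := classic (exists k, forall z, N z <-> M k z).
    have [Mb bk0 Jb _] := HJ k; have [Ms _ _] := HM k.
    apply: (@loc_principal_frac _ _ y (b k)) => //.
      move=> r [n Hr].
      have neq i : i <> k -> ~ (forall z, N z <-> M i z).
        move=> ik E; apply: (neqM i k ik) => z.
        by split=> [/E/eqNM|/eqNM/E].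
      (* With [f k = b k] and all other [f i] outside [N], the product is [b k] times a unit of
         [R_N]. *)
      have [f fP] : exists f : nat -> R, forall i,
          J i (f i) /\ if i == k then f i = b k else ~ N (f i).
        have ex i : exists j, J i j /\ if i == k then j = b k else ~ N j.
          have [->|/eqP ik] := eqVneq i k; first by exists (b k).
          by have [_ _ /(_ N maxN (neq i ik))] := HM i.
        exact: (choice _ ex).
      (* Raising [n] above [k] makes the index [k] occur in the product. *)
      have [//|c E] := In_le n (maxn n k.+1) r (leq_maxl _ _) Hr f.
        by move=> i _; case: (fP i).
      have lt_k : (k < maxn n k.+1)%N by rewrite leq_maxr.
      pose k' := Ordinal lt_k.
      exists (\prod_(i < maxn n k.+1 | i != k') f i), c; split.
        elim/big_rec: _ => // i p ik Np; apply: maximal_mulN => //.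
        by have [_] := fP i; rewrite -[nat_of_ord i == k]/(i == k') (negPf ik).
      have fk : f k' = b k by have [_] := fP k; rewrite eqxx.
      by rewrite -E [in RHS](bigD1 k') //= fk; ring.
    have [r [Ir rE]] := Iyb k.
    by exists r, (s k), 1; split=> //; [move/eqNM | rewrite -rE; ring].
  apply: (@loc_principal_frac _ _ y 1) => //; first exact: oner_neq0.
    move=> r [n Hr]; have [|t [c [Nt E]]] := avoid N n maxN _ r Hr.
      by move=> i _ eqN; apply: neqN; exists i.
    by exists t, c; rewrite mulr1.
  by exists y, 1, 1; split=> //; rewrite !mul1r.
have [l [lI lspan]] := invertible_fg invI.
have [n ln] : exists n, forall r, r \in l -> In n r.
  elim: l lI {lspan} => [|r l IH] lI; first by exists 0%N.
  have [|n ln] := IH; first by move=> q ql; apply: lI; rewrite inE ql orbT.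
  have [n' rn'] := lI r (mem_head _ _).
  exists (maxn n n') => q; rewrite inE => /orP[/eqP ->|/ln Hq].
    by apply: In_le rn'; rewrite leq_maxr.
  by apply: In_le Hq; rewrite leq_maxl.
have [r [Ir rE]] := Iyb n.
have [Mb bn0 _ _] := HJ n; have [Ms _ _] := HM n.
(* As [r] is already in [In n], it is a multiple of [y] at [M n]; with [r * b n = s n * y] this
   forces [t * s n] into [M n]. *)
have [|t [c [Mt E]]] := avoid (M n) n (maxM n) _ r (lspan _ _ (idIn n) ln Ir).
  by move=> i lt_in; apply: neqM => ni; rewrite ni ltnn in lt_in.
apply: (maximal_mulN (maxM n) Mt Ms).
have -> : t * s n = c * b n.
  apply: (mulIf y0); rewrite -mulrA -rE mulrA E; ring.
by have [[_ [_ MM]] _] := maxM n; apply: MM.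
Qed.

(** * Extraction of a sequence of distinct ideals, and conclusion *)

(** A choice function [G] maps each finite list to a set satisfying [P] and absent from it; [L n]
    lists the first [n] values, and the next one is [G (L n)]. *)
Lemma infinite_distinct_seq (P : (R -> Prop) -> Prop) :
  (forall (n : nat) (f : nat -> R -> Prop), exists N, P N /\
     forall i, (i < n)%N -> ~ (forall z, N z <-> f i z)) ->
  exists M : nat -> R -> Prop, (forall n, P (M n)) /\
    forall i j, i <> j -> ~ (forall z, M i z <-> M j z).
Proof.
move=> ex; pose d : R -> Prop := fun=> False.
have exG (l : seq (R -> Prop)) : exists N, P N /\
    forall i, (i < size l)%N -> ~ (forall z, N z <-> nth d l i z) by apply: ex.
have [G GP] := choice _ exG.
pose L := fix L n := if n is m.+1 then rcons (L m) (G (L m)) else [::].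
have sizeL n : size (L n) = n by elim: n => //= n IH; rewrite size_rcons IH.
have nthL n i : (i < n)%N -> nth d (L n) i = G (L i).
  elim: n => //= n IH; rewrite ltnS leq_eqVlt nth_rcons sizeL => /orP[/eqP ->|lt_in].
    by rewrite ltnn eqxx.
  by rewrite lt_in IH.
exists (fun n => G (L n)); split=> [n|i j ij E]; first by case: (GP (L n)).
wlog lt_ij : i j ij E / (i < j)%N => [IH|].
  have [/IH|/IH|//] := ltngtP i j; first by apply.
  by apply=> [ji|z]; [apply: ij | split=> /E].
have [_ /(_ i)] := GP (L j); rewrite sizeL nthL //; apply=> // z.
by split=> /E.
Qed.

End Ideals.

Theorem theorem12 (R : idomainType) :
  not_field R -> finitely_stable R -> LPI_domain R ->
  (forall M : R -> Prop, maximal_ideal M -> stable M) ->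
  finite_character R.
Proof.
move=> _ fs lpi stM x x0; apply: NNPP => noF.
have [|M [MP neqM]] := @infinite_distinct_seq R (fun M => maximal_ideal M /\ M x).
  (* If no such [N] existed, [f] would list all maximal ideals containing [x]. *)
  move=> n f; apply: NNPP => noN; apply: noF; exists n, f => N maxN Nx.
  apply: NNPP => noi; apply: noN; exists N; split=> // i lt_in E.
  by apply: noi; exists i.
have loc n := local_ideal fs lpi (proj1 (MP n)) (stM _ (proj1 (MP n))) x0
  (proj2 (MP n)).
have [J JP] := choice _ loc.
have [b bP] := choice _ JP.
have [s sP] := choice _ bP.
apply: (@no_infinite_comaximal_family R (x ^+ 2) M J b s) => //.
- by rewrite expf_neq0.
- by move=> n; case: (MP n).
- by move=> n; case: (sP n).
- by move=> n; case: (sP n).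
Qed.
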